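(* Let $p$ be a prime, $w\ge1$, and $\mu\ge1$ an integer with $2^\mu<p$. Let $C\subseteq\mathbb{F}_{p^w}^n$ be a linear $[n,k]$ code whose dual code $C^\perp$ has minimum distance $d^\perp$. Let $\boldsymbol\tau=(\tau^{(1)},\dots,\tau^{(n)})$ be any family of functions $\tau^{(j)}:\mathbb{F}_{p^w}\to\{0,1\}^\mu$, and let $c_\mu=\frac{2^\mu\sin(\pi/2^\mu)}{p\sin(\pi/p)}$. Then \[ SD(\boldsymbol\tau(C),\boldsymbol\tau(\mathcal U_n))\le\frac12\,p^{w(n-k)}\,c_\mu^{d^\perp}. \]
   Context: For $S\subseteq\mathbb{F}_{p^w}^n$, $\boldsymbol\tau(S)$ is the distribution of $(\tau^{(1)}(x_1),\dots,\tau^{(n)}(x_n))$ with $\mathbf x$ uniform on $S$; $\mathcal U_n=\mathbb{F}_{p^w}^n$. $SD(X,Y)=\frac12\sum_z|\Pr[X=z]-\Pr[Y=z]|$. *)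

(* Defs.v *)
From HB Require Import structures.
From mathcomp Require Import all_boot all_order all_algebra all_field.
From mathcomp Require Import reals trigo.
Set Implicit Arguments. Unset Strict Implicit. Unset Printing Implicit Defensive.
Import Order.TTheory GRing.Theory Num.Theory.
Local Open Scope ring_scope.

Section Defs.
Variable F : finFieldType.
Variable n : nat.

Definition dotv (x y : 'rV[F]_n) : F := \sum_(i < n) x ord0 i * y ord0 i.

Definition dual_code (C : {vspace 'rV[F]_n}) : {set 'rV[F]_n} :=
  [set y | [forall x : 'rV[F]_n, (x \in C) ==> (dotv x y == 0)]].

Definition hweight (x : 'rV[F]_n) : nat := #|[set i : 'I_n | x ord0 i != 0]|.

(* minimum distance of a set of vectors containing 0: minimum weight of its
   nonzero elements (convention: n.+1 if there is none). *)
Definition min_dist (D : {set 'rV[F]_n}) : nat :=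
  \big[minn/n.+1]_(x in D | x != 0) hweight x.

Definition tau_apply (mu : nat) (tau : 'I_n -> F -> mu.-tuple bool)
  (x : 'rV[F]_n) : {ffun 'I_n -> mu.-tuple bool} :=
  [ffun j => tau j (x ord0 j)].

Definition tau_distr (R : realType) (mu : nat) (tau : 'I_n -> F -> mu.-tuple bool)
  (S : {set 'rV[F]_n}) (z : {ffun 'I_n -> mu.-tuple bool}) : R :=
  #|[set x in S | tau_apply tau x == z]|%:R / #|S|%:R.

Definition SD_tau (R : realType) (mu : nat) (tau : 'I_n -> F -> mu.-tuple bool)
  (S T : {set 'rV[F]_n}) : R :=
  2^-1 * \sum_(z : {ffun 'I_n -> mu.-tuple bool})
     `|tau_distr R tau S z - tau_distr R tau T z|.
End Defs.

Definition c_mu (R : realType) (p mu : nat) : R :=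
  (2 ^+ mu * sin (pi / 2 ^+ mu)) / (p%:R * sin (pi / p%:R)).

(* Main.v *)
(** Write [1_C] as the average of the additive characters [x |-> chi (dotv x al)]
    over the dual code.  The difference of the two densities at [z] is then the sum
    over nonzero dual words [al] of products over [j] of character sums over
    [{y | tau j y = z j}], and summing absolute values over [z] turns each product
    into a product over [j] of sums over all values of [tau j].  Such a factor is at
    most [1] when [al j = 0], and at most [c_mu] otherwise.

    For the last bound put [h = pi/p], [m = 2^mu], [t = pi/m].  The real part, in
    any direction [th], of a sum of [p]-th roots of unity is controlled through
    [2 sin h cos phi = int_(phi-h)^(phi+h) cos]: the positive parts of
    [int_(phi-h)^(phi+h) (cos - cos t)], summed over the [p] angles [phi], are at most
    [int_(-t)^t (cos - cos t) = 2 sin t - 2 t cos t].  Using the same threshold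
    [cos t] for each of the [m] parts, the terms in [cos t] cancel after summation
    and no concavity argument is needed. *)
Require Import Defs.
From HB Require Import structures.
From mathcomp Require Import all_boot all_order all_algebra all_field.
From mathcomp Require Import classical_sets reals topology normedtype derive trigo.
From mathcomp Require Import complex ring lra.
Import numFieldNormedType.Exports.
Import Order.TTheory GRing.Theory Num.Theory Normc.
Local Open Scope ring_scope.

(** * Trigonometric inequalities *)

Section Trig.
Variable R : realType.
Implicit Types a b c t x y h th : R.

Lemma ler_cos x y : 0 <= x -> x <= y -> y <= pi -> cos y <= cos x :> R.
Proof.
move=> x0 xy ypi; rewrite leNgt ltr_cos ?in_itv /= -?leNgt //; apply/andP; split=> //.
- exact: le_trans x0 xy.
- exact: le_trans xy ypi.
Qed.

Lemma cosB2pi x : cos (x - pi *+ 2) = cos x.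
Proof. by rewrite -cosD2pi subrK. Qed.

(** This stands in for integration: integrals of [cos] are handled as differences of [sin] and
    estimated by the mean value theorem. *)
Lemma sin_MVT a b : a <= b ->
  exists2 c, a <= c <= b & sin b - sin a = cos c * (b - a) :> R.
Proof.
move=> ab.
have dsin x : x \in `]a, b[ -> is_derive x 1 (sin : R -> R) (cos x).
  by move=> _; apply: is_derive_sin.
have csin : {within `[a, b], continuous (sin : R -> R)}%classic.
  by apply: continuous_subspaceT => x; apply: continuous_sin.
have [c] := MVT_segment ab dsin csin.
by rewrite in_itv /= => cab e; exists c.
Qed.

(* [int_0^x (cos - cos t)] *)
Definition excess t x := sin x - x * cos t.

Lemma excessN t x : excess t (- x) = - excess t x.
Proof. by rewrite /excess sinN mulNr -opprB opprK addrC. Qed.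

(** The derivative [cos - cos t] is nonnegative on [[-t, t]]. *)
Lemma excess_le t a b : 0 <= t <= pi -> - t <= a -> a <= b -> b <= t ->
  excess t a <= excess t b.
Proof.
move=> /andP[t0 tpi] ta ab bt.
have [c /andP[ac cb] e] := sin_MVT _ _ ab.
suff : 0 <= (cos c - cos t) * (b - a) by rewrite mulrBl -e /excess; nra.
rewrite mulr_ge0 ?subr_ge0 //.
by rewrite -(cos_norm c) ler_cos // ler_norml; lra.
Qed.

(** The derivative [cos - cos t] is nonpositive on [[t, 2 pi - t]]. *)
Lemma excess_ge t a b : 0 <= t <= pi -> t <= a -> a <= b -> b <= pi *+ 2 - t ->
  excess t b <= excess t a.
Proof.
move=> /andP[t0 tpi] ta ab bt.
have [c /andP[ac cb] e] := sin_MVT _ _ ab.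
suff : 0 <= (cos t - cos c) * (b - a) by rewrite mulrBl -e /excess; nra.
rewrite mulr_ge0 ?subr_ge0 //.
have [cpi|pic] := leP c pi; first by rewrite ler_cos //; lra.
(* Beyond [pi], reflect [c] to [2 pi - c], which lies in [[t, pi]]. *)
rewrite -(cosN c) -(cosD2pi (- c)) ler_cos //; lra.
Qed.

(* [int_0^x (cos - cos t)^+], restricted to the window [-t, t] *)
Definition clamped t x := excess t (Num.max (- t) (Num.min x t)).

Lemma clamped_mid t x : - t <= x -> x <= t -> clamped t x = excess t x.
Proof. by move=> tx xt; rewrite /clamped min_l // max_r. Qed.

Lemma clamped_right t x : 0 <= t -> t <= x -> clamped t x = excess t t.
Proof. by move=> t0 tx; rewrite /clamped min_r // max_r //; lra. Qed.

Lemma clamped_left t x : 0 <= t -> x <= - t -> clamped t x = - excess t t.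
Proof. by move=> t0 tx; rewrite /clamped min_l ?max_l ?excessN //; lra. Qed.

Lemma clamped_le t a b : 0 <= t <= pi -> a <= b -> clamped t a <= clamped t b.
Proof.
move=> tpi ab; have /andP[t0 _] := tpi; apply: excess_le => //.
- by rewrite le_max lexx.
- by rewrite ge_max le_max lexx /= le_max le_min !ge_min ab lexx !orbT.
- by rewrite ge_max ge_min lexx orbT andbT; lra.
Qed.

(** On this range [cos - cos t] is nonpositive outside [[-t, t]], so discarding what [[a, b]] has
    there cannot lower the integral. The cases locate [a] and [b] relative to the window. *)
Lemma excess_sub_le_clamped t a b : 0 <= t <= pi ->
    t - pi *+ 2 <= a -> a <= b -> b <= pi *+ 2 - t ->
  excess t b - excess t a <= clamped t b - clamped t a.
Proof.
move=> tpi ta ab bt; have /andP[t0 t1] := tpi.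
have left x y : t - pi *+ 2 <= x -> x <= y -> y <= - t -> excess t y <= excess t x.
  move=> h1 h2 h3; rewrite -lerN2 -!excessN; apply: excess_ge => //; lra.
have [/ltW at_|ta'] := ltP a (- t).
  rewrite (clamped_left _ a) //.
  have [/ltW bt_|tb'] := ltP b (- t).
    by rewrite clamped_left // subrr subr_le0 left.
  have := left _ _ ta at_ (lexx _); rewrite excessN => ea.
  have [bt'|/ltW tb] := leP b t; first by rewrite clamped_mid //; lra.
  rewrite clamped_right //.
  have := excess_ge t t b tpi (lexx _) tb bt; lra.
have [at'|/ltW ta2] := leP a t; last first.
  rewrite !clamped_right ?subrr ?subr_le0 ?excess_ge //; lra.
rewrite (clamped_mid _ a) //.
have [bt'|/ltW tb] := leP b t; first by rewrite clamped_mid //; lra.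
rewrite clamped_right // lerB // excess_ge //.
Qed.

Lemma excess_arc t h x :
  excess t (x + h) - excess t (x - h) = 2 * sin h * cos x - 2 * h * cos t.
Proof. by rewrite /excess sinD sinB; ring. Qed.

(* For [th] in [-pi, pi], only the windows around [0] and [2 pi] meet the arcs. *)
Definition two_windows t x := clamped t x + clamped t (x - pi *+ 2).

(** The right side is nonnegative by monotonicity. The other bound matters only when [cos x > 0]:
    then [x] is within [pi / 2] of [0] or [2 pi], and the window there already dominates the arc. *)
Lemma arc_le_two_windows t h x : 0 <= t <= pi / 2 -> 0 <= h <= pi / 2 ->
    - pi <= x < pi *+ 3 ->
  Num.max 0 (2 * sin h * cos x - 2 * h * cos t) <=
    two_windows t (x + h) - two_windows t (x - h).
Proof.
move=> /andP[t0 t2] /andP[h0 h2] /andP[x0 x3]; have pi0 := pi_gt0 R.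
have tpi : 0 <= t <= pi by lra.
have m1 : clamped t (x - h) <= clamped t (x + h) by apply: clamped_le => //; lra.
have m2 : clamped t (x - h - pi *+ 2) <= clamped t (x + h - pi *+ 2).
  by apply: clamped_le => //; lra.
rewrite ge_max /two_windows; apply/andP; split; first by lra.
have [cx|cx] := leP (cos x) 0.
  suff : 2 * sin h * cos x - 2 * h * cos t <= 0 by lra.
  have sh : 0 <= sin h by rewrite sin_ge0_pi //; lra.
  have ct : 0 <= cos t by rewrite cos_ge0_pihalf //; lra.
  have : sin h * cos x <= 0 by rewrite mulr_ge0_le0.
  have : 0 <= h * cos t by rewrite mulr_ge0.
  lra.
(* This excludes the remaining positions of [x], after a shift by a full turn where needed. *)
have neg y : pi / 2 <= y -> y <= pi *+ 3 / 2 -> cos y <= 0.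
  move=> y1 y2; rewrite -oppr_ge0 -cosDpi -(cosD2pi (y + pi)).
  have -> : y + pi + pi *+ 2 = (y - pi) + pi *+ 2 + pi *+ 2 by rewrite !mulr2n; ring.
  by rewrite !cosD2pi cos_ge0_pihalf //; lra.
have [xl|xl] := ltP x (pi / 2).
  have [xs|xs] := leP x (- (pi / 2)).
    have := neg (x + pi *+ 2); rewrite cosD2pi; lra.
  have := excess_sub_le_clamped t (x - h) (x + h) tpi; rewrite excess_arc; lra.
have [xs|xs] := leP x (pi *+ 3 / 2).
  have := neg x; lra.
have [xb|xb] := ltP x (pi *+ 5 / 2); last first.
  have := neg (x - pi *+ 2); rewrite cosB2pi; lra.
have := excess_sub_le_clamped t (x - pi *+ 2 - h) (x - pi *+ 2 + h) tpi.
rewrite excess_arc cosB2pi (addrAC x _ (- h)) (addrAC x _ h); lra.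
Qed.

(** The [p] arcs of half-width [pi / p] tile one full turn, so the bounds by [two_windows] telescope
    to the increment across a single window. *)
Lemma sum_arcs_le (p : nat) t th : (1 < p)%N ->
    0 <= t <= pi / 2 -> pi / p%:R + t <= pi -> - pi <= th <= pi ->
  \sum_(r < p) Num.max 0 (2 * sin (pi / p%:R) * cos (2 * pi / p%:R * r%:R - th)
                          - 2 * (pi / p%:R) * cos t)
   <= 2 * sin t - 2 * t * cos t.
Proof.
move=> p1 t2 htpi /andP[th0 th1]; have pi0 := pi_gt0 R.
set h := pi / p%:R.
have pR : 2 <= p%:R :> R by rewrite ler_nat.
have hp : h * p%:R = pi by rewrite divfK // gt_eqF //; lra.
have h0 : 0 < h by rewrite divr_gt0 //; lra.
have h2 : 0 <= h <= pi / 2.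
  by rewrite ltW //= ler_pM2l // lef_pV2 // posrE; lra.
pose u (r : nat) := two_windows t (2 * h * r%:R - th - h).
have -> : 2 * sin t - 2 * t * cos t = u p - u 0%N.
  have /andP[t0 _] := t2.
  (* The copy shifted by [2 pi] at the upper end cancels the unshifted copy at the lower end. *)
  have -> : u p - u 0%N = clamped t (2 * pi - th - h) - clamped t (- th - h - pi *+ 2).
    rewrite /u /two_windows -[2 * h * p%:R]mulrA hp mulr0 add0r.
    have -> : 2 * pi - th - h - pi *+ 2 = - th - h by rewrite mulr_natl; ring.
    by ring.
  (* Since [h + t <= pi], the two remaining arguments lie on either side of the window. *)
  rewrite clamped_right ?clamped_left //; try lra.
  by rewrite /excess; ring.
rewrite -[leRHS](telescope_sumr u (leq0n p)) big_mkord; apply: ler_sum => r _.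
have rp : r%:R + 1 <= p%:R :> R by rewrite -(natrD _ r 1) ler_nat addn1.
have r0 : 0 <= r%:R :> R by [].
have e2 : 2 * pi / p%:R * r%:R - th = 2 * h * r%:R - th by rewrite /h; ring.
have hr : h * r%:R <= h * (p%:R - 1) by rewrite ler_pM2l //; lra.
have hr0 : 0 <= h * r%:R by rewrite mulr_ge0 // ltW.
have -> : u r.+1 = two_windows t (2 * h * r%:R - th + h).
  by rewrite /u -natr1; congr two_windows; ring.
by rewrite e2; apply: arc_le_two_windows => //; lra.
Qed.
End Trig.

(** * Monotonicity of [sin x / x] and bounds on [c_mu] *)

Section Sinc.
Variable R : realType.

(** The mean slope [cos c] of the sine on [[0, x]] is at least its mean slope [cos d] on [[x, y]],
    because [c <= x <= d]. *)
Lemma sinc_anti (x y : R) : 0 < x -> x <= y -> y <= pi -> x * sin y <= y * sin x.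
Proof.
move=> x0 xy ypi.
have [c /andP[c0 cx]] := sin_MVT R 0 x (ltW x0); rewrite sin0 !subr0 => ec.
have [d /andP[xd dy] ed] := sin_MVT R x y xy.
have cd : cos d <= cos c by apply: ler_cos; lra.
have : 0 <= x * (y - x) * (cos c - cos d).
  by rewrite !mulr_ge0 ?subr_ge0 // ltW.
have -> : x * (y - x) * (cos c - cos d) = cos c * x * (y - x) - x * (cos d * (y - x)) by ring.
rewrite -ec -ed; lra.
Qed.

Lemma c_mu_ge0 (p mu : nat) : (1 < p)%N -> (0 < mu)%N -> 0 <= c_mu R p mu.
Proof.
move=> p1 mu0; have pi0 := pi_gt0 R.
have sge (m : R) : 1 <= m -> 0 <= sin (pi / m).
  move=> m1; apply: sin_ge0_pi; rewrite divr_ge0 ?ler_pdivrMr ?ler_peMr //; lra.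
by rewrite divr_ge0 // mulr_ge0 ?exprn_ge0 ?sge ?ler1n ?(ltnW p1) // exprn_ege1 // ler1n.
Qed.

(** [c_mu] is the value of [sin x / x] at [pi / 2 ^ mu] divided by its value at the smaller point
    [pi / p]. *)
Lemma c_mu_le1 (p mu : nat) : (0 < mu)%N -> (2 ^ mu < p)%N -> c_mu R p mu <= 1.
Proof.
move=> mu0 mup; have pi0 := pi_gt0 R.
have m1 : 1 < 2 ^+ mu :> R by rewrite exprn_egt1 // ?lt0n_neq0 // ltr1n.
have mp : 2 ^+ mu < p%:R :> R by rewrite -natrX ltr_nat.
rewrite /c_mu; move: (2 ^+ mu) m1 mp => m m1 mp.
have p0 : 0 < p%:R :> R by lra.
have s0 : 0 < sin (pi / p%:R :> R).
  by rewrite sin_gt0_pi // divr_gt0 //= ltr_pdivrMr // ltr_pMr //; lra.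
rewrite ler_pdivrMr ?mulr_gt0 // mul1r.
have /= h := sinc_anti (pi / p%:R) (pi / m).
have {h} : pi / p%:R * sin (pi / m) <= pi / m * sin (pi / p%:R).
  apply: h; first by rewrite divr_gt0.
    by rewrite ler_pM2l // lef_pV2 ?posrE ?ltW //; lra.
  by rewrite ler_pdivrMr ?ler_peMr //; lra.
rewrite ![pi / _ * _]mulrAC ler_pdivrMr // [leRHS]mulrAC ler_pdivlMr; last by lra.
by rewrite -!mulrA ler_pM2l // [sin _ * m]mulrC [sin _ * p%:R]mulrC.
Qed.
End Sinc.

(** * Complex norms and roots of unity *)

Section NormC.
Variable R : realType.
Implicit Types z : R[i].

Lemma normc_sum (I : Type) (r : seq I) (P : pred I) (f : I -> R[i]) :
  normc (\sum_(i <- r | P i) f i) <= \sum_(i <- r | P i) normc (f i).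
Proof.
elim/big_ind2: _ => [|x a y b xa yb|//]; first by rewrite normc0.
by apply: le_trans (lerD xa yb); apply: le_normcD.
Qed.

Lemma normc_prod (I : Type) (r : seq I) (P : pred I) (f : I -> R[i]) :
  normc (\prod_(i <- r | P i) f i) = \prod_(i <- r | P i) normc (f i).
Proof. exact: (big_morph _ (@normcM R) (normc1 R)). Qed.

Lemma normcR (x : R) : normc x%:C%C = `|x|.
Proof. by rewrite /= expr0n addr0 sqrtr_sqr. Qed.

(** A complex number has its full length along its own direction; the angle is kept in the range
    that [sum_arcs_le] accepts. *)
Lemma normc_polar z : exists2 t : R, - pi <= t <= pi &
  normc z = complex.Re z * cos t + complex.Im z * sin t.
Proof.
have [z0|/eqP nz0] := eqVneq (normc z) 0.
  by exists 0; rewrite ?z0 ?(eq0_normc z0) /= ?mul0r ?addr0 // oppr_le0 pi_ge0.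
case: z nz0 => a b /=; set n := Num.sqrt _ => /eqP nz0.
have n0 : 0 < n by rewrite lt_def nz0 sqrtr_ge0.
have n2 : n ^+ 2 = a ^+ 2 + b ^+ 2 by rewrite sqr_sqrtr // addr_ge0 ?sqr_ge0.
have an : -1 <= a / n <= 1.
  by rewrite -ler_norml normrM normfV (gtr0_norm n0) ler_pdivrMr // mul1r
     -sqrtr_sqr ler_wsqrtr // lerDl sqr_ge0.
have t0 := acos_ge0 an; have tpi := acos_lepi an.
have pi0 := pi_gt0 R.
have sE : sin (acos (a / n)) = `|b| / n.
  rewrite sin_acos //; have -> : 1 - (a / n) ^+ 2 = (b / n) ^+ 2.
    rewrite !expr_div_n n2; field; rewrite -n2 expf_eq0 //=.
  by rewrite sqrtr_sqr normrM normfV (gtr0_norm n0).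
have cE : cos (acos (a / n)) = a / n by rewrite acosK // in_itv.
have fin : n = a * (a / n) + b * (b / n).
  by rewrite !mulrA -mulrDl -!expr2 -n2 expr2 mulfK.
(* [acos] only reaches [[0, pi]]; the sign of the imaginary part selects the angle or its
   opposite. *)
have [b0|b0] := leP 0 b.
  by exists (acos (a / n)); [lra|rewrite cE sE ger0_norm].
exists (- acos (a / n)); first by lra.
by rewrite cosN sinN cE sE ltr0_norm // mulNr opprK.
Qed.

Lemma ReM_sum (I : Type) (r : seq I) (P : pred I) (f : I -> R[i]) (u v : R) :
  complex.Re (\sum_(i <- r | P i) f i) * u + complex.Im (\sum_(i <- r | P i) f i) * v =
  \sum_(i <- r | P i) (complex.Re (f i) * u + complex.Im (f i) * v).
Proof.
elim/big_rec2: _ => [|i x y _ <-]; first by rewrite /= !mul0r addr0.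
by case: (f i) y => a b [c d] /=; ring.
Qed.

End NormC.

Section RootOfUnity.
Variables (R : realType) (p : nat).

Definition omega : R[i] := (cos (2 * pi / p%:R) +i* sin (2 * pi / p%:R))%C.

Lemma omegaX k : omega ^+ k =
  (cos (2 * pi / p%:R * k%:R) +i* sin (2 * pi / p%:R * k%:R))%C.
Proof.
elim: k => [|k IH]; first by rewrite mulr0 cos0 sin0.
have -> : 2 * pi / p%:R * k.+1%:R = 2 * pi / p%:R * k%:R + 2 * pi / p%:R :> R.
  by rewrite -(natr1 k); ring.
rewrite exprSr IH cosD sinD.
by congr Complex; rewrite addrC mulrC.
Qed.

Lemma omega_expp : (0 < p)%N -> omega ^+ p = 1.
Proof.
move=> p0; rewrite omegaX divfK ?pnatr_eq0 -?lt0n //.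
by rewrite mulr_natl cos2pi sin2pi.
Qed.

Lemma omega_neq1 : (1 < p)%N -> omega != 1.
Proof.
move=> p1; apply/eqP => -[c1 _]; have pi0 := pi_gt0 R.
have p2 : 2 <= p%:R :> R by rewrite ler_nat.
have : 2 * pi / p%:R = 0 :> R.
  apply: cos_inj; rewrite ?c1 ?cos0 // in_itv /= ?lexx ?pi_ge0 //.
  by rewrite divr_ge0 ?ler_pdivrMr //; nra.
apply/eqP; rewrite gt_eqF // divr_gt0 //; lra.
Qed.

Lemma normc_omegaX k : normc (omega ^+ k) = 1.
Proof. by rewrite omegaX /= cos2Dsin2 sqrtr1. Qed.

End RootOfUnity.

(** * Additive characters of a finite field *)

(** A nonzero functional over the prime field, in the role of the trace: some coordinate of [1] is
    nonzero, and a multiple of [1] normalises it. *)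
Lemma exists_Fp_functional (F : finFieldType) (p : nat) : p \in [pchar F] ->
  exists2 psi : F -> 'F_p, {morph psi : x y / x + y} & exists y, psi y = 1.
Proof.
move=> pF; pose L := pPrimeCharType pF : vectType 'F_p.
have: (1 : L) \in <<vbasis {:L}>>%VS by rewrite (span_basis (vbasisP _)) memvf.
move/coord_span => e1.
have [i ci] : exists i, coord (vbasis {:L}) i (1 : L) != 0.
  apply/existsP; apply: contra_neqT (oner_neq0 L) => /existsPn c0.
  rewrite e1 big1 // => i _.
  by have /negPn/eqP -> := c0 i; rewrite scale0r.
exists (coord (vbasis {:L}) i : F -> 'F_p) => [x y|].
  exact: (raddfD (coord (vbasis {:L}) i) (x : L) (y : L)).
exists ((coord (vbasis {:L}) i (1 : L))^-1 *: (1 : L)).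
by rewrite /= linearZ /= mulVf.
Qed.

(** Translation by [y] permutes [D] and multiplies the sum by [f y], which differs from [1]. *)
Lemma sum_char0 (A : idomainType) (V : finZmodType) (D : {set V}) (f : V -> A) y :
    (forall x, (x + y \in D) = (x \in D)) -> (forall x, f (x + y) = f x * f y) ->
    f y != 1 -> \sum_(x in D) f x = 0.
Proof.
move=> Dy fy fy1; set S := \sum_(x in D) _.
have : S = S * f y.
  rewrite {1}/S (reindex_inj (addIr y)) mulr_suml.
  by apply: eq_big => x; rewrite ?Dy.
move/eqP; rewrite -subr_eq0 -{1}[S]mulr1 -mulrBr mulf_eq0 subr_eq0 => /orP[/eqP //|].
by rewrite eq_sym (negPf fy1).
Qed.

Section Character.
Variables (R : realType) (p : nat) (F : finFieldType).
Hypothesis p_pr : prime p.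
Variable psi : F -> 'F_p.
Hypothesis psiD : {morph psi : x y / x + y}.
Hypothesis psi1 : exists y, psi y = 1.

Lemma psi0 : psi 0 = 0.
Proof. by apply: (addrI (psi 0)); rewrite -psiD !addr0. Qed.

Lemma psiMn x k : psi (x *+ k) = psi x *+ k.
Proof. by elim: k => [|k IH]; rewrite ?mulr0n ?psi0 // !mulrS psiD IH. Qed.

Definition chi (x : F) : R[i] := omega R p ^+ (psi x : nat).

Lemma chiD x y : chi (x + y) = chi x * chi y.
Proof.
rewrite /chi psiD -exprD expr_mod //.
by rewrite Fp_cast // omega_expp // prime_gt0.
Qed.

Lemma chi0 : chi 0 = 1.
Proof. by rewrite /chi psi0. Qed.

Lemma chi_sum (I : Type) (r : seq I) (P : pred I) (f : I -> F) :
  chi (\sum_(i <- r | P i) f i) = \prod_(i <- r | P i) chi (f i).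
Proof. exact: (big_morph _ chiD chi0). Qed.

Lemma chi_neq1 : exists y, chi y != 1.
Proof.
have [y e] := psi1; exists y; rewrite /chi e /= Fp_cast // modn_small ?prime_gt1 //.
by rewrite expr1 omega_neq1 // prime_gt1.
Qed.

(** The map [x |-> psi (al * x)] takes every residue equally often. *)
Lemma sum_psi (f : nat -> R) (al : F) : al != 0 ->
  p%:R * (\sum_(x : F) f (psi (al * x))) = #|F|%:R * \sum_(r < p) f r.
Proof.
move=> al0; have [y ye] := psi1.
have <- : \sum_(r : 'F_p) f r = \sum_(r < p) f r.
  by rewrite -!(big_mkord xpredT) Fp_cast.
have -> : \sum_x f (psi (al * x)) = \sum_x f (psi x).
  by rewrite [RHS](reindex_inj (mulfI al0)).
(* Translating [x] by [y *+ t] shifts [psi x] by [t], so all inner sums agree; for fixed [x],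
   [psi x + t] runs through all residues. *)
transitivity (\sum_(t : 'F_p) \sum_x f (psi x + t)).
  have sum_const (S : R) : p%:R * S = \sum_(t : 'F_p) S.
    by rewrite sumr_const card_Fp // mulr_natl.
  rewrite sum_const; apply: eq_bigr => t _.
  rewrite (reindex_inj (addIr (y *+ t))); apply: eq_bigr => x _.
  by rewrite psiD psiMn ye natr_Zp.
rewrite exchange_big /= mulr_natl -sumr_const; apply: eq_bigr => x _.
by rewrite [RHS](reindex_inj (addrI (psi x))).
Qed.

Lemma normc_sum_chi_le (B : finType) (tau : F -> B) (al : F) : al != 0 ->
    (1 < #|B|)%N -> (#|B| < p)%N ->
  \sum_(b : B) normc (\sum_(x | tau x == b) chi (al * x)) <=
    #|F|%:R * (#|B|%:R * sin (pi / #|B|%:R) / (p%:R * sin (pi / p%:R))).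
Proof.
move=> al0 m1 mp; have pi0 := pi_gt0 R.
set m := #|B| in m1 mp *; set h := pi / p%:R; set t := pi / m%:R.
have mR : 2 <= m%:R :> R by rewrite ler_nat.
have pR : 3 <= p%:R :> R by rewrite ler_nat; apply: leq_trans mp.
have hp : h * p%:R = pi by rewrite divfK // gt_eqF //; lra.
have tm : t * m%:R = pi by rewrite divfK // gt_eqF //; lra.
have h0 : 0 < h by rewrite divr_gt0 //; lra.
have t0 : 0 < t by rewrite divr_gt0 //; lra.
have h2 : h <= pi / 2 by rewrite ler_pM2l // lef_pV2 ?posrE; lra.
have t2 : t <= pi / 2 by rewrite ler_pM2l // lef_pV2 ?posrE; lra.
have sh : 0 < sin h by rewrite sin_gt0_pi //; lra.
pose arc th (r : nat) := 2 * sin h * cos (2 * pi / p%:R * r%:R - th) - 2 * h * cos t.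
pose K := 2 * sin t - 2 * t * cos t.
(* Projection onto the direction [th] of the sum turns each term, scaled by [2 sin h], into [arc]
   plus the constant [2 h cos t]. *)
have part b : 2 * sin h * normc (\sum_(x | tau x == b) chi (al * x)) <=
    #|F|%:R / p%:R * K + 2 * h * cos t * #|[pred x | tau x == b]|%:R.
  have [th thpi ->] := normc_polar _ (\sum_(x | tau x == b) chi (al * x)).
  rewrite ReM_sum mulr_sumr.
  have -> : \sum_(x | tau x == b) 2 * sin h *
      (complex.Re (chi (al * x)) * cos th + complex.Im (chi (al * x)) * sin th) =
      \sum_(x | tau x == b) arc th (psi (al * x)) +
      2 * h * cos t * #|[pred x | tau x == b]|%:R.
    rewrite mulr_natr -sumr_const -big_split /=; apply: eq_bigr => x _.
    by rewrite /chi omegaX /= /arc cosB subrK.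
  rewrite lerD2r.
  (* Taking positive parts over all of [F] makes the bound independent of the fibre over [b]. *)
  apply: (@le_trans _ _ (\sum_(x : F) Num.max 0 (arc th (psi (al * x))))).
    rewrite [leRHS](bigID (fun x => tau x == b)) /= ler_wpDr //.
      by apply: sumr_ge0 => x _; rewrite le_max lexx.
    by apply: ler_sum => x _; rewrite le_max lexx orbT.
  rewrite mulrAC ler_pdivlMr; last by lra.
  rewrite mulrC (sum_psi (fun r => Num.max 0 (arc th r))) //.
  rewrite ler_wpM2l //; apply: sum_arcs_le => //; first exact: prime_gt1.
    by rewrite t2 ltW.
  rewrite -/h; lra.
have : 2 * sin h * \sum_(b : B) normc (\sum_(x | tau x == b) chi (al * x)) <=
    #|F|%:R / p%:R * (2 * m%:R * sin t).
  rewrite mulr_sumr (le_trans (ler_sum _ (fun b _ => part b))) //.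
  rewrite big_split /= sumr_const -mulr_sumr -natr_sum.
  have -> : (\sum_(b : B) #|[pred x | tau x == b]|)%N = #|F|.
    rewrite -sum1_card (partition_big tau xpredT) //=.
    by apply: eq_bigr => b _; rewrite sum1_card.
  rewrite -/m le_eqVlt; apply/orP; left; apply/eqP.
  rewrite /K -[_ *+ m]mulr_natr.
  (* As [h p = pi = t m], the fibre sizes, adding up to [#|F|], contribute exactly what cancels the
     [cos t] terms of the [m] copies of [K]. *)
  have -> : h = t * m%:R / p%:R by rewrite tm.
  by field; lra.
move=> le; rewrite mulrA ler_pdivlMr; last by rewrite mulr_gt0 //; lra.
rewrite -(ler_pM2l (ltr0n _ 2)).
rewrite -(ler_pM2r (_ : 0 < p%:R^-1)); last by rewrite invr_gt0; lra.
apply: le_trans (le_trans _ le) _; rewrite le_eqVlt; apply/orP; left; apply/eqP.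
  by field; lra.
by field; lra.
Qed.
End Character.

(** * Linear codes and their duals *)

Section Dual.
Variables (F : finFieldType) (n : nat).
Implicit Types (x y al : 'rV[F]_n) (C : {vspace 'rV[F]_n}).

Lemma dotvDl x y al : dotv (x + y) al = dotv x al + dotv y al.
Proof. by rewrite -big_split; apply: eq_bigr => i _; rewrite mxE mulrDl. Qed.

Lemma dotvDr x y al : dotv al (x + y) = dotv al x + dotv al y.
Proof. by rewrite -big_split; apply: eq_bigr => i _; rewrite mxE mulrDr. Qed.

Lemma dotvZl a x al : dotv (a *: x) al = a * dotv x al.
Proof. by rewrite mulr_sumr; apply: eq_bigr => i _; rewrite mxE mulrA. Qed.

Lemma dotvZr a x al : dotv al (a *: x) = a * dotv al x.
Proof. by rewrite mulr_sumr; apply: eq_bigr => i _; rewrite mxE mulrCA. Qed.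

Lemma dotv0r x : dotv x 0 = 0.
Proof. by rewrite /dotv big1 // => i _; rewrite mxE mulr0. Qed.

Lemma dotv_delta i al : dotv (delta_mx ord0 i) al = al ord0 i.
Proof.
rewrite /dotv (bigD1 i) //= mxE !eqxx mul1r big1 ?addr0 // => j ji.
by rewrite mxE (negPf ji) mul0r.
Qed.

Lemma dotv_trmx x (u : 'cV[F]_n) : dotv x u^T = (x *m u) ord0 ord0.
Proof. by rewrite mxE; apply: eq_bigr => i _; rewrite mxE. Qed.

Lemma dual_codeP C al :
  reflect (forall x, x \in C -> dotv x al = 0) (al \in dual_code C).
Proof.
rewrite inE; apply: (iffP forallP) => H x; first by move=> xC; exact/eqP/(implyP (H x)).
by apply/implyP => /H/eqP.
Qed.

Lemma dual_code0 C : 0 \in dual_code C.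
Proof. by apply/dual_codeP => x _; rewrite dotv0r. Qed.

Lemma dual_code_addr C al be : be \in dual_code C ->
  (al + be \in dual_code C) = (al \in dual_code C).
Proof.
move=> /dual_codeP beC; apply/dual_codeP/dual_codeP => H x xC; move: (H x xC).
  by rewrite dotvDr beC // addr0.
by rewrite dotvDr beC // addr0.
Qed.

Lemma dual_codeZ C a al : al \in dual_code C -> a *: al \in dual_code C.
Proof.
move=> /dual_codeP aC; apply/dual_codeP => x /aC.
by rewrite dotvZr => ->; rewrite mulr0.
Qed.

(** The double dual lies in [C]: a vector outside the row space of a basis matrix is detected by
    some column of the cokernel matrix, and these columns are orthogonal to [C]. *)
Lemma notin_code C x : x \notin C -> exists2 al, al \in dual_code C & dotv x al != 0.
Proof.
move=> xC; pose B := \matrix_(i < \dim C) (vbasis C)`_i.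
have subB y : (y \in C) -> (y <= B)%MS.
  move=> /coord_vbasis ->; apply: summx_sub => i _; apply: scalemx_sub.
  by rewrite -(rowK (fun i => (vbasis C)`_i) i) row_sub.
have : ~~ (x <= B)%MS.
  apply: contra xC => /submxP[D ->]; rewrite mulmx_sum_row.
  apply: memv_suml => i _; rewrite rowK memvZ // vbasis_mem // mem_nth //.
  by rewrite size_tuple.
rewrite submxE => /rV0Pn[j xj].
have dotE y : dotv y (col j (cokermx B))^T = (y *m cokermx B) ord0 j.
  by rewrite dotv_trmx !mxE; apply: eq_bigr => i _; rewrite mxE.
exists (col j (cokermx B))^T; last by rewrite dotE.
apply/dual_codeP => y /subB; rewrite submxE dotE => /eqP ->.
by rewrite mxE.
Qed.

Lemma min_dist_le (D : {set 'rV[F]_n}) al :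
  al \in D -> al != 0 -> (min_dist D <= hweight al)%N.
Proof.
move=> alD al0; rewrite /min_dist.
have : al \in index_enum 'rV[F]_n by rewrite mem_index_enum.
elim: (index_enum _) => [//|y s IH]; rewrite inE big_cons => /orP[/eqP <-|/IH le].
  by rewrite alD al0 geq_minl.
by case: ifP => // _; rewrite (leq_trans (geq_minr _ _)).
Qed.
End Dual.

(** * Poisson summation over a code and its dual *)

Section Poisson.
Variables (R : realType) (p : nat) (F : finFieldType) (n : nat).
Hypothesis p_pr : prime p.
Variable psi : F -> 'F_p.
Hypothesis psiD : {morph psi : x y / x + y}.
Hypothesis psi1 : exists y, psi y = 1.
Variable C : {vspace 'rV[F]_n}.
Local Notation chi := (chi R p F psi).
Local Notation D := (dual_code C).

Lemma sum_chi_dual x :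
  \sum_(al in D) chi (dotv x al) = if x \in C then #|D|%:R else 0.
Proof.
case: ifPn => [xC|/notin_code[al alD xal]].
  rewrite -sum1_card natr_sum; apply: eq_bigr => al /dual_codeP -> //.
  by rewrite chi0.
have [y cy] := chi_neq1 R p F p_pr psi psi1.
(* The shift is scaled to have dot product [y] with [x], where [chi y != 1]. *)
apply: (sum_char0 R[i] _ D (fun be => chi (dotv x be)) ((y / dotv x al) *: al)) => [be|be|].
- by rewrite dual_code_addr // dual_codeZ.
- by rewrite dotvDr chiD.
- by rewrite dotvZr divfK.
Qed.

Lemma sum_chi_rV (al : 'rV[F]_n) : al != 0 -> \sum_x chi (dotv x al) = 0.
Proof.
move=> /rV0Pn[i ai]; have [y cy] := chi_neq1 R p F p_pr psi psi1.
have <- : \sum_(x in [set: 'rV[F]_n]) chi (dotv x al) = \sum_x chi (dotv x al).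
  by apply: eq_bigl => x; rewrite inE.
apply: (sum_char0 R[i] _ [set: 'rV[F]_n] (fun x => chi (dotv x al))
  ((y / al ord0 i) *: delta_mx ord0 i)) => [x|x|].
- by rewrite !inE.
- by rewrite dotvDl chiD.
- by rewrite dotvZl dotv_delta divfK.
Qed.

(** Double counting: the sum of [chi (dotv x al)] over all [x] and all dual words is evaluated in
    both orders. *)
Lemma card_code_dual : (#|C| * #|D|)%N = #|'rV[F]_n|.
Proof.
apply/eqP; rewrite -(eqr_nat R[i]) natrM; apply/eqP.
transitivity (\sum_x \sum_(al in D) chi (dotv x al)).
  rewrite (eq_bigr _ (fun x _ => sum_chi_dual x)) -big_mkcond /=.
  by rewrite sumr_const mulr_natl.
rewrite exchange_big /= (bigD1 0) ?dual_code0 //= [X in _ + X]big1 => [|al /andP[_]].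
  rewrite addr0 -sum1_card natr_sum; apply: eq_bigr => x _.
  by rewrite dotv0r chi0.
exact: sum_chi_rV.
Qed.

Lemma card_dual : #|D| = (#|F| ^ (n - \dim C))%N.
Proof.
have := card_code_dual; rewrite card_vspace card_mx mul1n.
(* This makes the truncated subtraction [n - \dim C] a true difference. *)
have dn : (\dim C <= n)%N.
  by have := dimvS (subvf C); rewrite dimvf /dim /= mul1n.
rewrite -[X in _ = (_ ^ X)%N](subnKC dn) expnD => /eqP.
by rewrite eqn_pmul2l ?expn_gt0 ?(ltnW (finNzRing_gt1 F)) // => /eqP.
Qed.

(** Once the indicator of [C] is expanded in characters, [card_code_dual] matches the normalisations
    and the zero word contributes the mean over the whole space. *)
Lemma code_mean_sub (f : 'rV[F]_n -> R[i]) :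
  (\sum_(x in C) f x) / #|C|%:R - (\sum_x f x) / #|'rV[F]_n|%:R =
  \sum_(al in D | al != 0) (\sum_x f x * chi (dotv x al)) / #|'rV[F]_n|%:R.
Proof.
have D0 : #|D|%:R != 0 :> R[i].
  by rewrite pnatr_eq0 -lt0n; apply/card_gt0P; exists 0; apply: dual_code0.
have C0 : #|C|%:R != 0 :> R[i].
  by rewrite pnatr_eq0 -lt0n; apply/card_gt0P; exists 0; apply: mem0v.
have -> : (\sum_(x in C) f x) / #|C|%:R =
    \sum_(al in D) (\sum_x f x * chi (dotv x al)) / #|'rV[F]_n|%:R.
  rewrite -mulr_suml exchange_big /=.
  have -> : \sum_x \sum_(al in D) f x * chi (dotv x al) = (\sum_(x in C) f x) * #|D|%:R.
    rewrite mulr_suml [RHS]big_mkcond; apply: eq_bigr => x _.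
    by rewrite -mulr_sumr sum_chi_dual; case: ifP => _; rewrite ?mulr0.
  by rewrite -card_code_dual natrM invfM mulrACA divff // mulr1.
rewrite (bigD1 0) ?dual_code0 //= (eq_bigr f) => [|x _]; last first.
  by rewrite dotv0r chi0 // mulr1.
by rewrite addrAC subrr add0r.
Qed.

Lemma sum_prod_rV (A : comPzRingType) (g : 'I_n -> F -> A) :
  \sum_(x : 'rV[F]_n) \prod_j g j (x ord0 j) = \prod_j \sum_y g j y.
Proof.
rewrite bigA_distr_bigA (reindex (fun h : {ffun 'I_n -> F} => \row_j h j)) /=.
  apply: eq_bigr => h _. by apply: eq_bigr => j _; rewrite mxE.
exists (fun x : 'rV[F]_n => [ffun j => x ord0 j]) => [h _|x _].
  by apply/ffunP => j; rewrite ffunE mxE.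
by apply/rowP => j; rewrite mxE ffunE.
Qed.

End Poisson.

(** * Leakage bound *)

Lemma real_complexB (R : realType) (a b : R) : (a - b)%:C%C = a%:C%C - b%:C%C.
Proof. exact: rmorphB. Qed.

Lemma normc_ge0 (R : realType) (z : R[i]) : 0 <= normc z.
Proof. by case: z => a b; apply: sqrtr_ge0. Qed.

Lemma normc_nat (R : realType) k : normc (k%:R : R[i]) = k%:R.
Proof. by rewrite -(rmorph_nat (real_complex R)) normcR ger0_norm. Qed.

(** The event for [z] is a conjunction over coordinates, so its indicator is a product; this lets
    the Fourier coefficients factor. *)
Lemma tau_distrE (R : realType) (F : finFieldType) (n mu : nat)
    (tau : 'I_n -> F -> mu.-tuple bool) (S : {set 'rV[F]_n})
    (z : {ffun 'I_n -> mu.-tuple bool}) :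
  (tau_distr R tau S z)%:C%C =
  (\sum_(x in S) \prod_j (tau j (x ord0 j) == z j)%:R) / #|S|%:R :> R[i].
Proof.
rewrite /tau_distr fmorph_div !rmorph_nat; congr (_ / _).
rewrite -sum1_card natr_sum big_mkcond [RHS]big_mkcond; apply: eq_bigr => x _.
rewrite inE; case: (x \in S) => //=; case: eqP => [<-|ne].
  by rewrite big1 // => j _; rewrite ffunE eqxx.
have [j ne_j] : exists j, tau j (x ord0 j) != z j.
  apply/existsP; apply: contra_notT ne => /existsPn e.
  by apply/ffunP => j; rewrite ffunE; apply/eqP/negPn/e.
by rewrite (bigD1 j) //= (negPf ne_j) mul0r.
Qed.

Section Leakage.
Variables (R : realType) (p : nat) (F : finFieldType) (n mu : nat).
Hypothesis p_pr : prime p.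
Variable psi : F -> 'F_p.
Hypothesis psiD : {morph psi : x y / x + y}.
Hypothesis psi1 : exists y, psi y = 1.
Variable C : {vspace 'rV[F]_n}.
Variable tau : 'I_n -> F -> mu.-tuple bool.
Local Notation chi := (chi R p F psi).
Local Notation D := (dual_code C).

Lemma tau_distr_sub_le z :
  `|tau_distr R tau [set x | x \in C] z -
    tau_distr R tau [set: 'rV[F]_n] z| <=
  \sum_(al in D | al != 0)
    \prod_j (normc (\sum_(y | tau j y == z j) chi (al ord0 j * y)) / #|F|%:R).
Proof.
pose f (x : 'rV[F]_n) : R[i] := \prod_j (tau j (x ord0 j) == z j)%:R.
rewrite -normcR real_complexB !tau_distrE cardsE cardsT.
rewrite (eq_bigl [in C]) => [|x]; last by rewrite inE.
rewrite [X in _ - X / _](eq_bigl predT) => [|x]; last by rewrite inE.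
rewrite (code_mean_sub R p F n p_pr psi psiD psi1 C f).
apply: le_trans (normc_sum _ _ _ _ _) _; apply: ler_sum => al _.
have -> : \sum_x f x * chi (dotv x al) =
    \prod_j \sum_(y | tau j y == z j) chi (al ord0 j * y).
  transitivity (\prod_j \sum_y (tau j y == z j)%:R * chi (al ord0 j * y)).
    rewrite -(sum_prod_rV F n _ (fun j y => (tau j y == z j)%:R * chi (al ord0 j * y))).
    apply: eq_bigr => x _; rewrite /f chi_sum // -big_split.
    by apply: eq_bigr => j _; rewrite [al _ _ * _]mulrC.
  apply: eq_bigr => j _; rewrite [RHS]big_mkcond; apply: eq_bigr => y _.
  by case: eqP; rewrite ?mul1r ?mul0r.
(* The factor [#|F| ^ n] is shared out as one [#|F|] per coordinate. *)
rewrite normcM normc_prod normcV normc_nat card_mx mul1n.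
by rewrite big_split /= prodr_const card_ord natrX exprVn.
Qed.

Lemma prod_bias_le (al : 'rV[F]_n) : (0 < mu)%N -> (2 ^ mu < p)%N ->
  \sum_(z : {ffun 'I_n -> mu.-tuple bool})
    \prod_j (normc (\sum_(y | tau j y == z j) chi (al ord0 j * y)) / #|F|%:R)
  <= c_mu R p mu ^+ hweight al.
Proof.
move=> mu0 mup; have cardB : #|{: mu.-tuple bool}| = (2 ^ mu)%N.
  by rewrite card_tuple card_bool.
have q0 : 0 < #|F|%:R :> R by rewrite ltr0n (ltn_trans _ (finNzRing_gt1 F)).
rewrite -(bigA_distr_bigA (fun j b =>
  normc (\sum_(y | tau j y == b) chi (al ord0 j * y)) / #|F|%:R)).
have c0 : 0 <= c_mu R p mu by rewrite c_mu_ge0 ?prime_gt1.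
have -> : c_mu R p mu ^+ hweight al =
    \prod_(j < n) (if al ord0 j != 0 then c_mu R p mu else 1).
  rewrite -big_mkcond prodr_const /hweight; congr (_ ^+ _).
  by apply: eq_card => j; rewrite !inE.
apply: ler_prod => j _; apply/andP; split.
  by apply: sumr_ge0 => b _; rewrite divr_ge0 ?normc_ge0 // ltW.
rewrite -mulr_suml ler_pdivrMr // mulrC.
case: eqVneq => [->|al0] /=; last first.
  have := normc_sum_chi_le R p F p_pr psi psiD psi1 _ (tau j) (al ord0 j) al0.
  rewrite cardB /c_mu natrX; apply=> //.
  by rewrite -[X in (X < _)%N](expn0 2) ltn_exp2l.
(* At a zero coordinate the triangle inequality suffices, since the fibres of [tau j] partition
   [F]. *)
rewrite mulr1 -sum1_card natr_sum [leRHS](partition_big (tau j) xpredT) //=.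
apply: ler_sum => b _; apply: le_trans (normc_sum _ _ _ _ _) _.
by apply: ler_sum => y _; rewrite normc_omegaX.
Qed.

(** Since [c_mu <= 1], the weight of each nonzero dual word may be lowered to the minimum distance,
    and there are at most [#|D|] such words. *)
Lemma SD_tau_le : (0 < mu)%N -> (2 ^ mu < p)%N ->
  SD_tau R tau [set x | x \in C] [set: 'rV[F]_n] <=
    2^-1 * #|D|%:R * c_mu R p mu ^+ min_dist D.
Proof.
move=> mu0 mup; rewrite -mulrA ler_pM2l ?invr_gt0 //.
have c0 : 0 <= c_mu R p mu by rewrite c_mu_ge0 ?prime_gt1.
apply: le_trans (ler_sum _ (fun z _ => tau_distr_sub_le z)) _.
rewrite exchange_big /= mulr_natl -[leRHS]sumr_const.
apply: (@le_trans _ _ (\sum_(al in D | al != 0) c_mu R p mu ^+ min_dist D)).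
  apply: ler_sum => al /andP[alD al0]; apply: le_trans (prod_bias_le al mu0 mup) _.
  by rewrite ler_wiXn2l ?c_mu_le1 // min_dist_le.
rewrite [leRHS](bigID (fun al => al != 0)) /= lerDl.
by apply: sumr_ge0 => al _; rewrite exprn_ge0.
Qed.
End Leakage.

Theorem theorem4p1 (R : realType) (p w mu n k : nat) (F : finFieldType)
  (C : {vspace 'rV[F]_n}) (tau : 'I_n -> F -> mu.-tuple bool) :
  prime p -> (1 <= w)%N -> (1 <= mu)%N -> (2 ^ mu < p)%N ->
  #|F| = (p ^ w)%N ->
  \dim C = k ->
  SD_tau R tau [set x | x \in C] [set: 'rV[F]_n]
    <= 2^-1 * (p%:R : R) ^+ (w * (n - k)) *
       c_mu R p mu ^+ min_dist (dual_code C).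
Proof.
move=> p_pr _ mu0 mup cardF dimC.
(* The cardinality [p ^ w] forces characteristic [p]. *)
have [psi psiD psi1] := exists_Fp_functional F p (card_finPcharP cardF p_pr).
apply: le_trans (SD_tau_le R p F n mu p_pr psi psiD psi1 C tau mu0 mup) _.
by rewrite (card_dual R p F n p_pr psi psiD psi1) cardF dimC -expnM natrX.
Qed.
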